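(* Let $k,a,b,r$ be integers with $k\geq b>a\geq 1$ and $r\geq 1$. The set $\mathcal{P}'_{a,b,k,r}$ of partitions $(\pi_1,\ldots,\pi_m)$ whose parts are all congruent to $a$ or $b$ modulo $k$ and for which there is no index $i$ with $\pi_i,\pi_{i+1},\ldots,\pi_{i+r}$ all congruent to $a$ modulo $k$ is a separable integer partition class with modulus $k$.
   Context: Partitions are non-increasing finite sequences of positive integers. For a positive integer $k$, a separable integer partition class $\mathcal{P}$ with modulus $k$ is a set of partitions for which there is a subset $\mathcal{B}\subset\mathcal{P}$ (the basis) such that for each $m\geq 1$ the number of partitions in $\mathcal{B}$ with $m$ parts is finite, every partition in $\mathcal{P}$ with $m$ parts is uniquely of the form $(b_1+\pi_1,\ldots,b_m+\pi_m)$ where $(b_1,\ldots,b_m)\in\mathcal{B}$ and $(\pi_1,\ldots,\pi_m)$ is a non-increasing sequence of nonnegative integers each divisible by $k$, and all partitions of this form lie in $\mathcal{P}$. *)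

(* Defs.v *)
From mathcomp Require Import all_boot.
From mathcomp Require Import boolp classical_sets cardinality.

Set Implicit Arguments.
Unset Strict Implicit.
Unset Printing Implicit Defensive.

Local Open Scope classical_set_scope.

Definition is_partition (s : seq nat) : Prop :=
  sorted geq s /\ {in s, forall x, 0 < x}.

(* The sequences (pi_1, ..., pi_m) added to a basis element; zero entries are
   allowed, so these need not be partitions. *)
Definition is_shift (k m : nat) (t : seq nat) : Prop :=
  [/\ size t = m, sorted geq t & {in t, forall x, k %| x}].

(* Only used on sequences of equal length, zip truncating to the shorter one. *)
Definition part_add (s t : seq nat) : seq nat :=
  [seq x.1 + x.2 | x <- zip s t].

(* The uniqueness is that of the pair (basis element, shift). *)
Definition separable_basis (k : nat) (P B : set (seq nat)) : Prop :=
  B `<=` P /\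
  forall m : nat, 0 < m ->
    [/\ finite_set [set s | B s /\ size s = m],
        forall s : seq nat, P s -> size s = m ->
          exists! bt : seq nat * seq nat,
            [/\ B bt.1, size bt.1 = m, is_shift k m bt.2
              & s = part_add bt.1 bt.2]
      & forall b t : seq nat, B b -> size b = m -> is_shift k m t ->
          P (part_add b t)].

Definition separable_class (k : nat) (P : set (seq nat)) : Prop :=
  P `<=` is_partition /\ exists B : set (seq nat), separable_basis k P B.

(* Positions are numbered from 0, so the window s_i, ..., s_(i+r) lies inside s
   exactly when i + r < size s. *)
Definition Pprime (a b k r : nat) : set (seq nat) :=
  [set s | [/\ is_partition s,
               {in s, forall x, x = a %[mod k] \/ x = b %[mod k]}
             & ~ exists i : nat, i + r < size s /\
                   forall j : nat, j <= r -> nth 0 s (i + j) = a %[mod k]]].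

(* Main.v *)
(** Membership in [Pprime a b k r] depends, among partitions, only on the
    sequence of residues modulo [k], and any such class is separable.  Reading a
    partition from its smallest part upwards, replace each part by the least
    number with the same residue that is at least the new part below it (at
    least 1 for the smallest part).  The fixed points of this reduction form the
    basis, and the amounts subtracted form the shift. *)
Require Import Defs.
From mathcomp Require Import all_boot zify.
From mathcomp Require Import boolp classical_sets cardinality.

Set Implicit Arguments.
Unset Strict Implicit.
Unset Printing Implicit Defensive.

(** The default [1] turns the inequality into positivity of [x] when [s] is empty, so one condition
    serves at every step of an induction. *)
Lemma is_partition_cons x s :
  is_partition (x :: s) <-> head 1 s <= x /\ is_partition s.
Proof.
split.
- move=> [hs hp]; split.
    case: s hs hp => [|y s] /=; first by move=> _ /(_ x); apply; rewrite inE.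
    by move=> /andP[].
  by split; [exact: path_sorted hs|move=> y ys; apply: hp; rewrite inE ys orbT].
- move=> [hx [hs hp]]; split.
    by case: s hx hs {hp} => //= y s -> ->.
  move=> y; rewrite inE => /orP[/eqP->|]; last exact: hp.
  case: s hx {hs} hp => //= z s hx hp.
  by apply: leq_trans hx; apply: hp; rewrite inE eqxx.
Qed.

Lemma is_shift_cons k m x t :
  is_shift k m.+1 (x :: t) <-> [/\ head 0 t <= x, k %| x & is_shift k m t].
Proof.
split.
- move=> [[ht] hs hd]; split.
  + by case: t hs {ht hd} => //= y t /andP[].
  + by apply: hd; rewrite inE eqxx.
  + split=> //; first exact: path_sorted hs.
    by move=> y yt; apply: hd; rewrite inE yt orbT.
- move=> [hx hk [ht hs hd]]; split.
  + by rewrite /= ht.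
  + by case: t hx hs {ht hd} => //= y t -> ->.
  + by move=> y; rewrite inE => /orP[/eqP->//|]; exact: hd.
Qed.

Fixpoint reduced (k : nat) (s : seq nat) : seq nat :=
  if s is x :: s' then
    let h := head 1 (reduced k s') in (h + (x - h) %% k) :: reduced k s'
  else [::].

Fixpoint excess (k : nat) (s : seq nat) : seq nat :=
  if s is x :: s' then
    let h := head 1 (reduced k s') in (x - h) %/ k * k :: excess k s'
  else [::].

Lemma size_reduced k s : size (reduced k s) = size s.
Proof. by elim: s => //= x s ->. Qed.

Lemma reduced_idem k s : reduced k (reduced k s) = reduced k s.
Proof. by elim: s => //= x s ->; rewrite addKn modn_mod. Qed.

(** This makes the truncated subtraction [x - h] in [reduced] and [excess] exact on partitions. *)
Lemma head_reduced_le k s : is_partition s -> head 1 (reduced k s) <= head 1 s.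
Proof.
elim: s => //= x s IH /is_partition_cons[hx /IH hs].
by rewrite -leq_subRL ?leq_mod // (leq_trans hs).
Qed.

Lemma reduced_partition k s : is_partition (reduced k s).
Proof. by elim: s => //= x s IH; apply/is_partition_cons; rewrite leq_addr. Qed.

Lemma reduced_mod k s : is_partition s ->
  [seq x %% k | x <- reduced k s] = [seq x %% k | x <- s].
Proof.
elim: s => //= x s IH /is_partition_cons[hx hs]; rewrite IH //; congr cons.
by rewrite modnDmr subnKC // (leq_trans (head_reduced_le k hs)).
Qed.

Lemma part_add_reduced_excess k s :
  is_partition s -> part_add (reduced k s) (excess k s) = s.
Proof.
elim: s => //= x s IH /is_partition_cons[hx hs].
rewrite /part_add /= -/(part_add _ _) IH //; congr cons.
by rewrite -addnA (addnC (_ %% k)) -divn_eq subnKC //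
  (leq_trans (head_reduced_le k hs)).
Qed.

(** The two defaults agree: the empty case reads [0 = 1 - 1]. *)
Lemma head_excess k s :
  head 0 (excess k s) = head 1 s - head 1 (reduced k s).
Proof.
case: s => //= x s; rewrite subnDA.
exact: (canRL (addnK _) (esym (divn_eq _ _))).
Qed.

(** Monotonicity: by [head_excess], the entry that follows is a multiple of [k] not exceeding
    [x - h], where [h] is the reduced part below [x]; the new entry is the largest such multiple. *)
Lemma excess_shift k s : is_partition s -> is_shift k (size s) (excess k s).
Proof.
elim: s => // x s IH /is_partition_cons[hx hs] /=.
apply/is_shift_cons; split; [|exact: dvdn_mull|exact: IH].
have [_ _ hd] := IH hs.
have /divnK <- : k %| head 0 (excess k s).
  by case: (excess k s) hd => //= y t; apply; rewrite inE eqxx.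
by rewrite leq_mul2r leq_div2r ?orbT // head_excess // leq_sub2r.
Qed.

Lemma part_add_partition k m s t : is_partition s -> size s = m ->
  is_shift k m t -> is_partition (part_add s t).
Proof.
elim: s m t => [|x s IH] [|m] [|u t] //.
move=> /is_partition_cons[hx hs] [hm] /is_shift_cons[hu _ ht].
apply/is_partition_cons; split; last exact: IH ht.
case: ht => hsz _ _.
by case: s t hx hu hm hsz {IH hs} => [|y s] [|v t] //=; lia.
Qed.

Lemma part_add_mod k m s t : size s = m -> is_shift k m t ->
  [seq x %% k | x <- part_add s t] = [seq x %% k | x <- s].
Proof.
elim: s m t => [|x s IH] [|m] [|u t] //; first by move=> _ [].
move=> [hm] /is_shift_cons[_ /eqP hu ht] /=.
by rewrite -modnDmr hu addn0 (IH m).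
Qed.

(** Source of uniqueness: reduction recovers a basis element from any of its shifts, because adding
    a multiple of [k] to a part leaves its residue above the reduced part below unchanged. *)
Lemma reduced_part_add k m b t : size b = m -> is_shift k m t ->
  reduced k b = b -> reduced k (part_add b t) = b.
Proof.
elim: b m t => [|x b IH] [|m] [|u t] //; first by move=> _ [].
move=> [hm] /is_shift_cons[_ hu ht] /= [hx hb].
rewrite -/(part_add b t) (IH m) //; congr cons.
(* Being fixed by [reduced] already forces [head 1 b <= x], so adding [u] commutes with the
   subtraction. *)
rewrite hb in hx; have hle : head 1 b <= x by rewrite -hx leq_addr.
by rewrite -addnBAC // -modnDmr (eqP hu) addn0.
Qed.

Lemma part_add_inj s t t' : size t = size s -> size t' = size s ->
  part_add s t = part_add s t' -> t = t'.
Proof.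
elim: s t t' => [|x s IH] [|u t] [|u' t'] //= [ht] [ht'] [/addnI-> h].
by rewrite (IH t t').
Qed.

(** Gives finiteness of the basis: starting from [1], each part exceeds the one below by less than
    [k], and the largest part bounds the others. The empty case, with default head [1], accounts for
    [.+2]. *)
Lemma reduced_bound k s : 0 < k ->
  {in reduced k s, forall x, x < (size s * k).+2}.
Proof.
move=> k0; have hd : head 1 (reduced k s) < (size s * k).+2.
  elim: s => //= x s; have := ltn_pmod (x - head 1 (reduced k s)) k0; nia.
have [] := reduced_partition k s.
case: (reduced k s) hd => // y c /= hy; rewrite path_sortedE; last first.
  by move=> ? ? ? /= h1 h2; exact: leq_trans h1.
move=> /andP[/allP hc _] _ x; rewrite inE => /orP[/eqP->//|/hc /= hx].
exact: leq_ltn_trans hx hy.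
Qed.

Local Open Scope classical_set_scope.

Lemma finite_bounded_seqs m N :
  finite_set [set s : seq nat | size s = m /\ {in s, forall x, x < N}].
Proof.
apply: (@sub_finite_set _ _
  ((fun t : m.-tuple 'I_N => map val t) @` setT)); last first.
  by apply: finite_image; exact: finite_finset.
move=> s [hm hs].
(* All entries are below [N], so [insub] drops none and [s] lifts to an [m]-tuple over ['I_N]. *)
have hsz : size (pmap insub s : seq 'I_N) == m.
  rewrite size_pmap_sub -hm; apply/eqP/esym/eqP.
  by rewrite eq_sym -all_count; apply/allP.
exists (Tuple hsz) => //=; rewrite (pmap_filter (@insubK _ _ _)).
by apply/all_filterP/allP => x /hs hx; rewrite isSome_insub.
Qed.

Lemma separable_class_of_residues k (P : set (seq nat)) : 0 < k ->
  P `<=` is_partition ->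
  (forall s t, P s -> is_partition t ->
     [seq x %% k | x <- t] = [seq x %% k | x <- s] -> P t) ->
  separable_class k P.
Proof.
move=> k0 hP hmod; split=> //.
exists [set s | P s /\ reduced k s = s]; split=> [s []//|m _]; split.
- apply: sub_finite_set (finite_bounded_seqs m (m * k).+2).
  by move=> s [[_ hs] <-]; split=> //; rewrite -{1}hs; exact: reduced_bound.
- move=> s Ps hm; have hs := hP _ Ps.
  exists (reduced k s, excess k s); split => /=.
    split; last by rewrite part_add_reduced_excess.
    + split.
        exact: hmod Ps (reduced_partition k s) (reduced_mod k hs).
      exact: reduced_idem.
    + by rewrite size_reduced.
    + by rewrite -hm; exact: excess_shift.
  move=> [b t] /= [[_ hb] hbm ht hst].
  (* Reducing [s] determines [b]; then [t] follows by cancelling [b] from [s]. *)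
  have hbE : reduced k s = b by rewrite hst (reduced_part_add hbm).
  rewrite hbE; congr pair; apply: (@part_add_inj b).
  + by case: (excess_shift k hs) => -> _ _; rewrite hm.
  + by case: ht => ->.
  + by rewrite -hst -hbE part_add_reduced_excess.
- move=> b t [Pb _] hbm ht.
  exact: hmod Pb (part_add_partition (hP _ Pb) hbm ht) (part_add_mod hbm ht).
Qed.

Theorem theorem3p5 (k a b r : nat) (hbk : b <= k) (hab : a < b) (ha : 1 <= a)
  (hr : 1 <= r) : separable_class k (Pprime a b k r).
Proof.
apply: separable_class_of_residues; [lia|by move=> s []|].
move=> s t [_ hres hwin] ht hmod.
have hsz : size t = size s by move/(congr1 size): hmod; rewrite !size_map.
have hnth i : i < size s -> nth 0 t i = nth 0 s i %[mod k].
  move=> hi; have := congr1 (fun u => nth 0 u i) hmod.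
  by rewrite !(nth_map 0) ?hsz.
split=> // [x /(nthP 0)[i hi <-]|[i [hi hw]]].
  by rewrite hsz in hi; rewrite hnth //; apply: hres; rewrite mem_nth.
(* A forbidden window of [t] occupies the same positions in [s], all of them in range, so [hnth]
   applies to each. *)
apply: hwin; exists i; rewrite -hsz; split=> // j hj.
by rewrite -hnth ?hw // -hsz; lia.
Qed.
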